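(* For every relation $R\subseteq\mathbb{Z}^{\mathbf{x}}\times\mathbb{Z}^{\mathbf{x}}$, $$\mathrm{wrs}(R)=\mathrm{wnt}(R)=\mathrm{gfp}(\mathrm{pre}_R).$$
   Context: $\mathbf{x}=\{x_1,\dots,x_N\}$, $N>0$, is a set of integer variables and $\mathbb{Z}^{\mathbf{x}}$ the set of valuations $\mathbf{x}\to\mathbb{Z}$. For $S\subseteq\mathbb{Z}^{\mathbf{x}}$, $\mathrm{pre}_R(S)=\{\nu\mid\exists\nu'\in S.\ (\nu,\nu')\in R\}$. $\mathrm{gfp}(F)$ is the largest set $S$ with $F(S)=S$. A set $S\subseteq\mathbb{Z}^{\mathbf{x}}$ is recurrent for $R$ if $S\subseteq\mathrm{pre}_R(S)$; $\mathrm{wrs}(R)$ (weakest recurrent set) is the union of all recurrent sets for $R$. A set $S$ is a non-termination precondition for $R$ if for each $\nu\in S$ there is an infinite sequence $\nu=\nu_0,\nu_1,\dots$ of valuations with $(\nu_i,\nu_{i+1})\in R$ for all $i\ge0$; $\mathrm{wnt}(R)$ (weakest non-termination precondition) is the union of all non-termination preconditions for $R$. *)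

(* Defs.v *)
From mathcomp Require Import all_boot all_algebra.
From mathcomp Require Import boolp classical_sets.

Set Implicit Arguments.
Unset Strict Implicit.
Unset Printing Implicit Defensive.

Local Open Scope classical_set_scope.

(* The variable x_k is encoded by the index k - 1 of 'I_N. *)
Definition valuation (N : nat) : Type := {ffun 'I_N -> int}.

Definition pre (N : nat) (R : set (valuation N * valuation N))
    (S : set (valuation N)) : set (valuation N) :=
  [set nu | exists2 nu', S nu' & R (nu, nu')].

Definition recurrent (N : nat) (R : set (valuation N * valuation N))
    (S : set (valuation N)) : Prop :=
  S `<=` pre R S.

Definition wrs (N : nat) (R : set (valuation N * valuation N)) :
    set (valuation N) :=
  \bigcup_(S in [set S | recurrent R S]) S.

Definition nonterm_precondition (N : nat)
    (R : set (valuation N * valuation N)) (S : set (valuation N)) : Prop :=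
  forall nu, S nu ->
    exists s : nat -> valuation N,
      s 0 = nu /\ forall i : nat, R (s i, s i.+1).

Definition wnt (N : nat) (R : set (valuation N * valuation N)) :
    set (valuation N) :=
  \bigcup_(S in [set S | nonterm_precondition R S]) S.

(* "G = gfp(F)" is a predicate because an arbitrary operator F need not have a
   largest fixed point; is_gfp F G asserts that it exists and is G (it is
   unique by antisymmetry of inclusion). *)
Definition is_gfp (T : Type) (F : set T -> set T) (G : set T) : Prop :=
  F G = G /\ forall S : set T, F S = S -> S `<=` G.

(* Main.v *)
(** Iterating a choice of [R]-successors inside a recurrent set yields infinite
    runs, so recurrent sets are non-termination preconditions. Conversely, the
    tail of an infinite run is an infinite run, so every non-termination
    precondition lies in [pre R (wnt R)]; and prepending a transition to an
    infinite run gives an infinite run, so [pre R (wnt R)] lies in [wnt R]. *)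

Require Import Defs.
From mathcomp Require Import all_boot all_algebra.
From mathcomp Require Import boolp classical_sets.

Lemma recurrent_nonterm (N : nat) (R : set (valuation N * valuation N))
    (S : set (valuation N)) :
  recurrent R S -> nonterm_precondition R S.
Proof.
move=> recS nu Snu.
have [f fP] : exists f : valuation N -> valuation N,
    forall x, S x -> S (f x) /\ R (x, f x).
  (* [choice] needs a value at every valuation, so the condition is guarded by [S x]; outside [S]
     the value [x] is a dummy. *)
  have /choice[f fP] x : exists y, S x -> S y /\ R (x, y).
    have [/recS[y Sy Rxy]|nSx] := pselect (S x); first by exists y.
    by exists x.
  by exists f.
have Sf i : S (iter i f nu) by elim: i => //= i /fP[].
by exists (fun i => iter i f nu); split=> // i; have [] := fP _ (Sf i).
Qed.

Lemma wntP (N : nat) (R : set (valuation N * valuation N))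
    (nu : valuation N) :
  wnt R nu <-> exists s : nat -> valuation N,
    s 0 = nu /\ forall i : nat, R (s i, s i.+1).
Proof.
split=> [[S ntS /ntS//]|run].
(* The singleton suffices: only the start of a run has to lie in a non-termination precondition. *)
by exists [set nu]%classic => //= _ ->.
Qed.

Lemma pre_wnt (N : nat) (R : set (valuation N * valuation N)) :
  pre R (wnt R) = wnt R.
Proof.
apply/seteqP; split=> nu.
  case=> nu' /wntP[s [s0 Rs]] Rnu; apply/wntP.
  exists (fun i => if i is j.+1 then s j else nu).
  by split=> // -[|i]; rewrite ?s0.
move=> /wntP[s [<- Rs]]; exists (s 1) => //.
by apply/wntP; exists (s \o succn); split=> // i; apply: Rs.
Qed.

Lemma recurrent_sub_wnt (N : nat) (R : set (valuation N * valuation N))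
    (S : set (valuation N)) :
  recurrent R S -> (S `<=` wnt R)%classic.
Proof. by move=> /recurrent_nonterm ntS nu Snu; exists S. Qed.

Theorem lemma3p6 (N : nat) (hN : 0 < N)
    (R : set (valuation N * valuation N)) :
  wrs R = wnt R /\ is_gfp (pre R) (wnt R).
Proof.
split; last first.
  split=> [|S preS]; first exact: pre_wnt.
  (* A fixed point of [pre R] is in particular recurrent. *)
  by apply: recurrent_sub_wnt; rewrite /recurrent preS.
apply/seteqP; split=> [nu [S recS Snu]|nu wntnu].
  exact: recurrent_sub_wnt recS _ Snu.
(* As a fixed point of [pre R], [wnt R] is itself a member of the union [wrs R]. *)
by exists (wnt R) => //=; rewrite /recurrent pre_wnt.
Qed.
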